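(* For all integers $r\ge 2$ and $3\le k\le r+1$, $$0\le \frac{k-2}{r}-\pi(H_k^r)\le \frac{128}{r}\left(\sqrt{s\log\frac{er}{s}}+\log\frac{er}{s}\right),$$ where $s=\min\{k-2,\,r-k+2\}$.
   Context: An $r$-graph is an $r$-uniform hypergraph. For $r\ge 2$ and $3\le k\le r+1$, $H_k^r$ denotes the $r$-graph on $r+1$ vertices with exactly $k$ edges (unique up to isomorphism, since each $r$-subset of an $(r+1)$-set omits exactly one vertex). An $r$-graph $G$ is $H$-free if it contains no copy of $H$ as a (not necessarily induced) subgraph. $\mathrm{ex}(n,H)$ is the maximum number of edges in an $H$-free $r$-graph on $n$ vertices, and the Turán density is $\pi(H)=\lim_{n\to\infty}\mathrm{ex}(n,H)/\binom{n}{r}$. $\log$ denotes the natural logarithm and $e$ its base. *)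

(* Defs.v *)
From mathcomp Require Import all_boot all_order all_algebra.
From mathcomp Require Import all_classical all_reals all_analysis.

Set Implicit Arguments.
Unset Strict Implicit.
Unset Printing Implicit Defensive.

Import Order.TTheory GRing.Theory Num.Theory.
Import numFieldNormedType.Exports.

Local Open Scope ring_scope.

(* A hypergraph on a finite vertex type is identified with its edge set. *)
Definition is_rgraph (r : nat) (V : finType) (G : {set {set V}}) : bool :=
  [forall e in G, #|e| == r].

(* Copies are not required to be induced. *)
Definition contains_copy (V W : finType)
    (G : {set {set V}}) (H : {set {set W}}) : bool :=
  [exists f : {ffun W -> V},
     injectiveb f && [forall e in H, (f @: (e : {set W})) \in G]].

Definition is_free (V W : finType)
    (H : {set {set W}}) (G : {set {set V}}) : bool :=
  ~~ contains_copy G H.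

(* As soon as H has an edge, the edgeless r-graph is H-free, so the maximum
   ranges over a nonempty family. *)
Definition turan_number (r : nat) (W : finType) (H : {set {set W}})
    (n : nat) : nat :=
  \max_(G : {set {set 'I_n}} | is_rgraph r G && is_free H G) #|G|.

Definition turan_density (R : realType) (r : nat) (W : finType)
    (H : {set {set W}}) : R :=
  limn (fun n : nat => (turan_number r H n)%:R / ('C(n, r))%:R : R).

(* The representative of H_k^r on 'I_r.+1 whose edges omit one of the vertices
   0, ..., k - 1; card_Hrk and Hrk_unique justify the choice. *)
Definition Hrk (r k : nat) : {set {set 'I_r.+1}} :=
  [set [set~ i] | i : 'I_r.+1 & (i < k)%N].

Lemma Hrk_rgraph (r k : nat) : is_rgraph r (Hrk r k).
Proof.
apply/forall_inP => e /imsetP[i _ ->].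
by rewrite cardsC1 card_ord.
Qed.

Lemma card_Hrk (r k : nat) : (k <= r.+1)%N -> #|Hrk r k| = k.
Proof.
move=> hk; rewrite card_imset; last by move=> i j /finset.setC_inj/finset.set1_inj.
rewrite -sum1_card.
under eq_bigl do rewrite inE.
by rewrite (big_ord_narrow hk) /= sum1_card card_ord.
Qed.

Lemma Hrk_unique (r k : nat) (V : finType) (G : {set {set V}}) :
  #|V| = r.+1 -> is_rgraph r G -> #|G| = k ->
  exists2 f : 'I_r.+1 -> V, bijective f &
    G = [set f @: (e : {set 'I_r.+1}) | e in Hrk r k].
Proof.
move=> hV /forall_inP Gr hk.
pose A := [set v : V | [set~ v] \in G].
have GE : G = [set [set~ v] | v in A].
  apply/setP => e; apply/idP/imsetP => [eG|[v]]; last by rewrite inE => ? ->.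
  have /cards1P[v hv] : #|~: e| == 1%N.
    by rewrite cardsCs finset.setCK hV (eqP (Gr _ eG)) subSnn.
  by exists v; rewrite ?inE -hv finset.setCK.
have cA : #|A| = k.
  by rewrite -hk [in RHS]GE card_imset // => i j /finset.setC_inj/finset.set1_inj.
pose s := enum A ++ enum (~: A).
have sz : size s = r.+1 by rewrite size_cat -!cardE cardsC hV.
have us : uniq s.
  rewrite cat_uniq !enum_uniq andbT /=; apply/hasPn => x.
  by rewrite !mem_enum inE.
have [v0 _] : exists v0 : V, v0 \in V by apply/card_gt0P; rewrite hV.
pose f (i : 'I_r.+1) := nth v0 s i.
have fi : injective f.
  move=> i j /eqP; rewrite /f nth_uniq ?sz // => /eqP; exact: val_inj.
have fb : bijective f by apply: inj_card_bij => //; rewrite hV card_ord.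
have fA i : (f i \in A) = (i < k)%N.
  rewrite /f nth_cat -cardE cA; case: ltnP => h.
    by rewrite -mem_enum mem_nth // -cardE cA.
  have : nth v0 (enum (~: A)) (i - k) \in enum (~: A).
    apply: mem_nth; rewrite -cardE cardsCs finset.setCK hV cA.
    by rewrite ltn_sub2r // (leq_ltn_trans h).
  by rewrite mem_enum inE => /negbTE.
have fC i : f @: [set~ i] = [set~ f i].
  apply/setP => v; have [g fg gf] := fb.
  rewrite -(gf v) mem_imset // !inE; congr (~~ _).
  by apply/eqP/eqP => [->|/fi].
exists f => //; rewrite GE; apply/setP => e; apply/imsetP/imsetP.
  move=> [v vA ->]; have [g fg gf] := fb.
  exists [set~ g v]; last by rewrite fC gf.
  by apply: imset_f; rewrite inE -fA gf.
move=> [_ /imsetP[i + ->] ->]; rewrite inE => ik.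
by exists (f i); rewrite ?fA.
Qed.

(* Main.v *)
Require Import Defs.
From mathcomp Require Import all_boot all_order all_algebra.
From mathcomp Require Import all_classical all_reals all_analysis.
From mathcomp Require Import perm ring lra zify.

Set Implicit Arguments.
Unset Strict Implicit.
Unset Printing Implicit Defensive.

Import Order.TTheory GRing.Theory Num.Theory.
Import numFieldNormedType.Exports.

(** Write m = k - 2 and, as in the theorem, s = min(m, r - m) and
    L = log(e r / s).

    Upper bound.  In an H_k^r-free r-graph every (r+1)-set contains at most
    m + 1 edges, so an edge e together with an outside vertex u yields at most
    m pairs of edges that differ by exchanging u for a vertex of e.  Counted
    over (r-1)-sets these pairs form the second moment of the codegree, and
    Cauchy-Schwarz turns the resulting inequality into a density at most
    m / r + o(1) (sqr_sum_leq, sum_sqr_codegree, turan_number_upper).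

    Lower bound.  Place the vertices on a cycle Z_n.  For a shift c, let an
    r-set e be an edge when no arc of length lam(e) = c - (sum of e) mod n
    contains more than m points of e.  If T has r + 1 points and T minus v is
    an edge, then the arc that ends just before v and has length
    lam(T - v) = c - (sum of T) + v starts at a point that depends on T only;
    it holds at most m points of T, so v is one of the first m + 1 points of T
    met from that start, and T contains at most m + 1 edges
    (cyclic_graph_free).  Averaging over c shows that some shift yields a
    density at least the mean, over uniform lam in [0, n), of the probability
    that a random r-set has no arc of length lam with more than m points
    (sum_cyclic_graph).

    An arc of length lam holds r lam / n points on average, so lengths below
    n m / r should be safe, up to fluctuations.  With y = m - r lam / n, the
    probability that some arc of length lam is overfull is at most
    exp(E - b y), with b of order 1 / (sqrt(s / L) + 1) and E of order L
    (overfull_sets_le_exp); summing over lam costs (E + 1) / b in the number of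
    points, which is of order sqrt(s L) + L (turan_density_lower).

    The number of arcs must enter this estimate only through r / s, because
    L stays bounded when s is of order r.  So arcs are not counted one by one:
    n / h starting points g, with h a sixteenth of the arc length, are fixed,
    every arc is the difference of two arcs starting at one of them, and the
    lengths of these vary in a range controlled by a Doob-type maximal
    inequality (maximal_prefix).  Long arcs are replaced by their complements,
    whence the symmetric role of m and r - m. *)

(** * Existence of the density *)

Lemma turan_numberP (r n k : nat) (G : {set {set 'I_n}}) :
  is_rgraph r G -> is_free (Hrk r k) G -> (#|G| <= turan_number r (Hrk r k) n)%N.
Proof.
by move=> Gr Gf; apply: leq_bigmax_cond; rewrite Gr Gf.
Qed.

(** Double counting of the pairs (edge, vertex outside the edge): deleting any
    of the n + 1 vertices leaves an H-free graph on n vertices. *)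
Lemma turan_step (r n k : nat) :
  ((n.+1 - r) * turan_number r (Hrk r k) n.+1 <=
   n.+1 * turan_number r (Hrk r k) n)%N.
Proof.
rewrite {1}/turan_number; elim/big_ind: _ => [|x y hx hy|G /andP[Gr Gf]].
- by rewrite muln0.
- by rewrite /maxn; case: ifP.
pose del (v : 'I_n.+1) := [set e : {set 'I_n} | (lift v @: e) \in G].
have delr v : is_rgraph r (del v).
  apply/forall_inP => e; rewrite inE => /(forall_inP Gr).
  by rewrite card_imset //; exact: lift_inj.
have delf v : is_free (Hrk r k) (del v).
  apply: contra Gf => /existsP[f /andP[/injectiveP fi /forall_inP fG]].
  apply/existsP; exists [ffun i => lift v (f i)]; apply/andP; split.
    by apply/injectiveP => i j; rewrite !ffunE => /lift_inj/fi.
  apply/forall_inP => e /fG; rewrite inE -imset_comp.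
  by congr (_ \in G); apply: eq_imset => i /=; rewrite ffunE.
have card_del v : #|del v| = #|[set e in G | v \notin e]|.
  have li : injective (fun e : {set 'I_n} => lift v @: e).
    by apply: imset_inj; exact: lift_inj.
  rewrite -(card_imset (mem (del v)) li); apply: eq_card => e.
  apply/imsetP/idP => [[e' + ->]|].
    rewrite !inE => -> /=; apply/imsetP => -[x _ /eqP].
    by rewrite (negbTE (neq_lift _ _)).
  rewrite inE => /andP[eG ve].
  have E : e = lift v @: [set x | lift v x \in e].
    apply/setP => x; apply/idP/imsetP => [xe|[y + ->]]; last by rewrite inE.
    case: (unliftP v x) => [j xj|xv]; first by exists j; rewrite ?inE -?xj.
    by rewrite -xv xe in ve.
  by exists [set x | lift v x \in e]; rewrite // inE -E.
have -> : ((n.+1 - r) * #|G| = \sum_(v : 'I_n.+1) #|del v|)%N.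
  under eq_bigr => v _ do rewrite card_del -sum1_card.
  under eq_bigr => v _ do under eq_bigl do rewrite inE.
  rewrite (exchange_big_dep (mem G)) /=; last by move=> v e _ /andP[].
  rewrite mulnC -sum_nat_const; apply: eq_bigr => e eG.
  have <- : #|~: e| = (n.+1 - r)%N.
    by rewrite cardsCs finset.setCK card_ord (eqP (forall_inP Gr e eG)).
  rewrite sum1_card.
  by apply: eq_card => v; rewrite [RHS]unfold_in !inE eG.
rewrite -[X in (_ <= X * _)%N](card_ord n.+1) -sum_nat_const; apply: leq_sum => v _.
exact: turan_numberP.
Qed.

Local Open Scope ring_scope.

Section TuranDensity.
Variables (R : realType) (r k : nat).

Let u (n : nat) : R := (turan_number r (Hrk r k) n)%:R / ('C(n, r))%:R.

Lemma density_step (n : nat) : (r <= n)%N -> u n.+1 <= u n.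
Proof.
move=> rn; rewrite /u.
have C0 : (0 : R) < ('C(n, r))%:R by rewrite ltr0n bin_gt0.
have C1 : (0 : R) < ('C(n.+1, r))%:R by rewrite ltr0n bin_gt0 leqW.
rewrite ler_pdivrMr // mulrAC ler_pdivlMr // -!natrM ler_nat.
rewrite -(@leq_pmul2l (n.+1 - r)) ?subn_gt0 ?ltnS //.
rewrite mulnA (leq_trans (leq_mul (turan_step r n k) (leqnn _))) //.
by rewrite mulnAC (mul_bin_down n.+1 r) [X in (_ <= _ * X)%N]mulnC mulnA.
Qed.

Lemma density_anti (n p : nat) : (r <= n)%N -> (n <= p)%N -> u p <= u n.
Proof.
move=> rn /subnKC <-; elim: (p - n)%N => [|i IH]; first by rewrite addn0.
by rewrite addnS (le_trans (density_step _)) // (leq_trans rn) ?leq_addr.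
Qed.

Lemma density_cvg : cvgn u.
Proof.
apply/cvg_ex; exists (limn (fun n => u (n + r)%N)); rewrite -(cvg_shiftn r).
apply: (@nonincreasing_is_cvgn R (fun n => u (n + r)%N)).
  by move=> i j ij; rewrite density_anti ?leq_addl ?leq_add2r.
exists 0 => _ [i _ <-]; exact: divr_ge0.
Qed.

Lemma turan_density_le (n : nat) :
  (r <= n)%N -> turan_density R r (Hrk r k) <= u n.
Proof.
move=> rn; apply: limr_le; first exact: density_cvg.
by exists n => // p /= np; exact: density_anti.
Qed.

Lemma turan_density_ge (a : R) :
  (forall n, exists2 p, (n <= p)%N & a <= u p) ->
  a <= turan_density R r (Hrk r k).
Proof.
move=> h; apply: limr_ge; first exact: density_cvg.
exists r => // n /= rn; have [p np ap] := h n.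
by rewrite (le_trans ap) // density_anti.
Qed.

End TuranDensity.

(** * The upper bound *)

Local Open Scope nat_scope.

(** If k facets of T were edges, an enumeration of T that lists the k omitted
    vertices first would be a copy of the forbidden graph. *)
Lemma free_card_faces (r k : nat) (V : finType) (G : {set {set V}})
    (T : {set V}) :
  is_free (Hrk r k) G -> #|T| = r.+1 ->
  #|[set v in T | T :\ v \in G]| < k.
Proof.
move=> Gf cT; rewrite ltnNge; apply: contra Gf => kA.
set A := [set v in T | _] in kA.
have AT : A \subset T by apply/fintype.subsetP => v; rewrite inE => /andP[].
pose s := enum A ++ enum (T :\: A).
have sT : s =i T.
  move=> v; rewrite mem_cat !mem_enum !inE.
  by case: (v \in T); rewrite ?andbF // andbT; case: (_ \in G).
have us : uniq s.
  rewrite cat_uniq !enum_uniq andbT /=; apply/hasPn => x.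
  by rewrite !mem_enum inE => /andP[].
have sz : size s = r.+1.
  by rewrite size_cat -!cardE cardsD (finset.setIidPr AT) cT subnKC // -cT subset_leq_card.
have [v0 _] : exists v0 : V, v0 \in T by apply/card_gt0P; rewrite cT.
pose f (i : 'I_r.+1) := nth v0 s i.
have fi : injective f.
  move=> i j /eqP; rewrite /f nth_uniq ?sz // => /eqP; exact: val_inj.
have fT i : f i \in T by rewrite -sT mem_nth // sz.
have fA (i : 'I_r.+1) : i < k -> f i \in A.
  move=> ik; rewrite /f nth_cat -cardE (leq_trans ik kA).
  by rewrite -mem_enum mem_nth // -cardE (leq_trans ik kA).
have fimT : f @: [set: 'I_r.+1] = T.
  apply/eqP; rewrite eqEcard cT card_imset // cardsT card_ord leqnn andbT.
  by apply/fintype.subsetP => _ /imsetP[i _ ->].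
apply/existsP; exists [ffun i => f i]; apply/andP; split.
  by apply/injectiveP => i j; rewrite !ffunE => /fi.
apply/forall_inP => e /imsetP[i + ->]; rewrite inE => /fA.
rewrite inE => /andP[_]; congr (_ \in G).
rewrite -fimT; apply/setP => v; rewrite !inE; apply/andP/imsetP.
  move=> [vi /imsetP[j _ vj]]; exists j; rewrite ?ffunE // !inE.
  by apply: contraNneq vi => <-; rewrite vj.
move=> [j]; rewrite !inE ffunE => ji ->; split; first by rewrite (inj_eq fi).
exact: imset_f.
Qed.

(** Pairs (S, x) with x added to S and pairs (e, x) with x removed from e are
    the same data; this is used for sums of naturals and of reals. *)
Lemma big_remove (V : finType) (T : Type) (idx : T) (op : Monoid.com_law idx)
    (G : {set {set V}}) (r : nat) (F : {set V} -> V -> T) :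
  is_rgraph r.+1 G ->
  \big[op/idx]_(S : {set V} | #|S| == r)
     \big[op/idx]_(x | (x \notin S) && (x |: S \in G)) F S x =
  \big[op/idx]_(e in G) \big[op/idx]_(x in e) F (e :\ x) x.
Proof.
move=> /forall_inP Gr; rewrite !pair_big_dep /=.
rewrite (reindex_onto (fun p : {set V} * V => (p.1 :\ p.2, p.2))
                      (fun p : {set V} * V => (p.2 |: p.1, p.2))) /=; last first.
  by move=> [S x] /= /andP[_ /andP[xS _]]; rewrite setU1K.
apply: eq_big => [[e x]|[e x] //] /=.
rewrite !inE eqxx /= -pair_eqE /= eqxx andbT.
apply/idP/idP => [/andP[/andP[_ +] /eqP ex]|/andP[eG xe]].
  by rewrite ex => ->; rewrite -ex setU11.
rewrite finset.setD1K // eG eqxx !andbT.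
by have := Gr e eG; rewrite (cardsD1 x) xe.
Qed.

Section Codegree.
Variables (V : finType) (G : {set {set V}}).

Definition codegree (S : {set V}) : nat :=
  \sum_(x | (x \notin S) && (x |: S \in G)) 1.

Lemma sum_codegree (r : nat) : is_rgraph r.+1 G ->
  \sum_(S : {set V} | #|S| == r) codegree S = r.+1 * #|G|.
Proof.
move=> Gr; rewrite (big_remove _ (fun _ _ => 1) Gr) mulnC -sum_nat_const.
apply: eq_bigr => e eG; rewrite sum1_card; exact/eqP/(forall_inP Gr).
Qed.

(** The sum counts the pairs of edges e, f that share an r-set, with the set:
    each e contributes r + 1 pairs with f = e, and for each vertex u outside e
    at most k pairs with f in u |: e, since u |: e has at most k + 1 facets in
    G, one of which is e. *)
Lemma sum_sqr_codegree (r k : nat) :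
  is_rgraph r.+1 G -> is_free (Hrk r.+1 k.+2) G ->
  \sum_(S : {set V} | #|S| == r) codegree S ^ 2 <=
  #|G| * (r.+1 + (#|V| - r.+1) * k).
Proof.
move=> Gr Gf.
under eq_bigr => S _.
  by rewrite -mulnn {1}/codegree big_distrl /=; under eq_bigr do rewrite mul1n; over.
rewrite (big_remove _ (fun S _ => codegree S) Gr) -sum_nat_const; apply: leq_sum => e eG.
have ce : #|e| = r.+1 by apply/eqP/(forall_inP Gr).
have codegE x : x \in e ->
    codegree (e :\ x) = 1 + \sum_(u in ~: e) (u |: (e :\ x) \in G).
  move=> xe; rewrite /codegree (bigD1 x) /=; last first.
    by rewrite setD11 /= finset.setD1K.
  congr (_ + _); rewrite big_mkcond [RHS]big_mkcond /=; apply: eq_bigr => u _.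
  rewrite !inE; have [->|ux] := eqVneq u x; first by rewrite xe andbF.
  by rewrite andbT; case: (u \in e); case: (_ \in G).
under eq_bigr => x xe do rewrite codegE //.
rewrite big_split /= sum_nat_const muln1 ce leq_add2l exchange_big /=.
have -> : #|V| - r.+1 = #|~: e| by rewrite cardsCs finset.setCK ce.
rewrite -sum_nat_const; apply: leq_sum => u; rewrite inE => ue.
have cT : #|u |: e| = r.+2 by rewrite cardsU1 ue ce.
have := free_card_faces Gf cT.
rewrite (cardsD1 u) !inE eqxx /= setU1K // eG add1n !ltnS; apply: leq_trans.
rewrite -sum1_card big_mkcond [X in _ <= X]big_mkcond /=; apply: leq_sum => x _.
rewrite !inE; case: ifP => // xe; have xu : x != u by apply: contraNneq ue => <-.
rewrite xu /= orbT /=; have -> : (u |: e) :\ x = u |: (e :\ x).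
  by apply/setP => y; rewrite !inE; case: eqVneq => [->|]; rewrite ?(negbTE xu).
by case: (_ \in G).
Qed.

End Codegree.

Lemma sqr_sum_leq (I : finType) (P : pred I) (d : I -> nat) :
  (\sum_(i | P i) d i) ^ 2 <= #|P| * \sum_(i | P i) d i ^ 2.
Proof.
rewrite -(@leq_pmul2l 2) // -mulnn big_distrlr /= big_distrr /=.
have -> : 2 * (#|P| * \sum_(i | P i) d i ^ 2) =
    \sum_(i | P i) \sum_(j | P j) (d i ^ 2 + d j ^ 2).
  under [RHS]eq_bigr do rewrite big_split /=.
  rewrite big_split /= sum_nat_const exchange_big /= sum_nat_const.
  by rewrite addnn mul2n.
apply: leq_sum => i _; rewrite big_distrr /=; apply: leq_sum => j _.
exact: nat_Cauchy.
Qed.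

Lemma turan_number_upper (r k n : nat) : r < n ->
  turan_number r.+1 (Hrk r.+1 k.+2) n * (r.+1 * (n - r)) <=
  'C(n, r.+1) * (r.+1 + (n - r.+1) * k).
Proof.
move=> rn; rewrite /turan_number; elim/big_ind: _ => [//|x y hx hy|G /andP[Gr Gf]].
  by rewrite /maxn; case: ifP.
have [->|G0] := posnP #|G|; first by rewrite mul0n.
have := sqr_sum_leq (fun S : {set 'I_n} => #|S| == r) (codegree G).
rewrite sum_codegree // => /leq_trans/(_ (leq_mul (leqnn _) (sum_sqr_codegree Gr Gf))).
have -> : #|(fun S : {set 'I_n} => #|S| == r)| = 'C(n, r).
  rewrite -[in RHS](card_ord n) -card_draws; apply: eq_card => S.
  by rewrite inE.
rewrite card_ord expnMn -!mulnn [X in _ <= X]mulnCA mulnA mulnC leq_pmul2l // => h.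
have r0 : 0 < r.+1 by [].
rewrite -(leq_pmul2l r0) [X in _ <= X]mulnA mul_bin_left -mulnA.
have -> : r.+1 * (#|G| * (r.+1 * (n - r))) = (n - r) * (r.+1 * r.+1 * #|G|).
  ring.
exact: leq_mul.
Qed.

Local Open Scope ring_scope.

Lemma turan_density_upper (R : realType) (r k : nat) :
  turan_density R r.+1 (Hrk r.+1 k.+2) <= k%:R / r.+1%:R.
Proof.
have r0 : (0 : R) < r.+1%:R by rewrite ltr0n.
apply/ler_addgt0Pr => /= e e0.
pose j := Num.truncn e^-1.
have je : (j.+1%:R)^-1 <= e.
  rewrite invf_ple ?posrE ?ltr0n //; apply/ltW.
  by rewrite truncnS_gt.
pose n := (r.+1 + j)%N.
have rn : (r.+1 <= n)%N by rewrite leq_addr.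
apply: le_trans (turan_density_le R k.+2 rn) _.
have C0 : (0 : R) < ('C(n, r.+1))%:R by rewrite ltr0n bin_gt0.
rewrite ler_pdivrMr //.
have := turan_number_upper k rn.
have -> : (n - r = j.+1)%N by rewrite /n addSnnS addKn.
have -> : (n - r.+1 = j)%N by rewrite /n addKn.
rewrite -(ler_nat R) !natrM natrD natrM => h.
have j0 : (0 : R) < j.+1%:R by rewrite ltr0n.
rewrite -(ler_pM2r (mulr_gt0 r0 j0)) (le_trans h) // [X in _ <= X]mulrAC [X in _ <= X]mulrC ler_pM2l //.
rewrite mulrDl mulrA divfK ?gt_eqF //.
have : 1 <= e * j.+1%:R by rewrite -ler_pdivrMr // mul1r.
have : j%:R <= j.+1%:R :> R by rewrite ler_nat.
have : (0 : R) <= k%:R by [].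
nra.
Qed.

(** * The cyclic construction *)

Local Open Scope nat_scope.

Section Arcs.
Variable n : nat.
Implicit Types (e : {set 'I_n.+1}) (a v : 'I_n.+1).

Definition arc_count e a (t : nat) : nat := #|[set v in e | (v - a)%R < t]|.

Lemma arc_count_full e a : arc_count e a n.+1 = #|e|.
Proof. by apply: eq_card => v; rewrite !inE ltn_ord andbT. Qed.

Lemma arc_count_mono e a s t : s <= t -> arc_count e a s <= arc_count e a t.
Proof.
move=> st; apply/subset_leq_card/fintype.subsetP => v; rewrite !inE.
by case/andP=> -> /= /leq_trans; apply.
Qed.

Lemma val_subZp (x y : 'I_n.+1) :
  (x - y)%R = (if y <= x then x - y else x + n.+1 - y) :> nat.
Proof.
have xn := ltn_ord x; have yn := ltn_ord y.
rewrite /= modnDmr; case: leqP => yx.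
  by rewrite addnBA 1?ltnW // addnC -addnBA // modnDl modn_small //; lia.
by rewrite modn_small; lia.
Qed.

Lemma arc_countE e a t :
  arc_count e a t = \sum_(v in e) ((v - a)%R < t).
Proof.
rewrite /arc_count -sum1_card big_mkcond [RHS]big_mkcond /=.
by apply: eq_bigr => v _; rewrite inE; case: (v \in e); case: (_ < t).
Qed.

(** The bound s + t <= n + 1 makes the two consecutive arcs disjoint on the
    cycle. *)
Lemma arc_countD e a s t : s + t <= n.+1 ->
  arc_count e a (s + t) = arc_count e a s + arc_count e (a + inZp s)%R t.
Proof.
have [sn stn|ns stn] := leqP s n; last first.
  have -> : t = 0 by lia.
  rewrite addn0 -[LHS]addn0; congr (_ + _); apply/esym/eqP.
  by rewrite cards_eq0; apply/eqP/setP => v; rewrite !inE ltn0 andbF.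
rewrite !arc_countE -big_split; apply: eq_bigr => v _.
have -> : (v - (a + inZp s) = (v - a) - inZp s)%R.
  by rewrite GRing.opprD GRing.addrA.
move: (v - a)%R => u; have un := ltn_ord u.
rewrite val_subZp; have -> : (inZp s : 'I_n.+1) = s :> nat by apply: modn_small.
case: (leqP s u) => su; first by rewrite ltn_subLR.
rewrite (leq_trans su) ?leq_addr //.
by have /negbTE -> : ~~ (u + n.+1 - s < t) by lia.
Qed.

Lemma arc_count_shift e a t :
  arc_count e a t = arc_count [set (v - a)%R | v in e] 0%R t.
Proof.
rewrite /arc_count -(card_imset _ (@GRing.addIr _ (- a)%R)).
apply: eq_card => x; apply/imsetP/idP => [[v + ->]|].
  by rewrite !inE GRing.subr0 => /andP[ve ->]; rewrite andbT; apply: (imset_f (fun v => v - a)%R).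
rewrite inE GRing.subr0 => /andP[/imsetP[v ve ->] h].
by exists v; rewrite // inE ve.
Qed.

End Arcs.

Section CyclicGraph.
Variables (n r m : nat).

Definition overfull_sets (lam : nat) : {set {set 'I_n.+1}} :=
  [set e : {set 'I_n.+1} | (#|e| == r) && [exists a, m < arc_count e a lam]].

Definition cyclic_graph (c : 'I_n.+1) : {set {set 'I_n.+1}} :=
  [set e : {set 'I_n.+1} | (#|e| == r) && (e \notin overfull_sets (c - \sum_(v in e) v)%R)].

Lemma cyclic_graph_rgraph c : is_rgraph r (cyclic_graph c).
Proof. by apply/forall_inP => e; rewrite inE => /andP[]. Qed.

(** All the facets of T that are edges see arcs with the same starting point
    a.  The one whose omitted vertex comes last from a has all the other
    omitted vertices in its arc, so there are at most m + 1 of them. *)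
Lemma cyclic_graph_free c : m < r -> is_free (Hrk r m.+2) (cyclic_graph c).
Proof.
move=> mr; apply/negP => /existsP[f /andP[/injectiveP fi /forall_inP fG]].
pose T := f @: [set: 'I_r.+1].
pose a := (\sum_(v in T) v - c)%R.
have TD i : f @: [set~ i] = T :\ f i.
  apply/setP => v; rewrite !inE; apply/imsetP/andP.
    move=> [j]; rewrite !inE => ji ->.
    by rewrite (inj_eq fi) ji imset_f.
  by move=> [vi /imsetP[j _ vj]]; exists j; rewrite // !inE -(inj_eq fi) -vj.
have few (i : 'I_r.+1) : i < m.+2 -> arc_count (f @: [set~ i]) a (f i - a)%R <= m.
  move=> im; have /fG : [set~ i] \in Hrk r m.+2 by apply: imset_f; rewrite inE.
  have -> : (f i - a = c - \sum_(v in f @: [set~ i]) v)%R.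
    rewrite TD /a (big_setD1 (f i)) ?imset_f ?inE //=.
    by rewrite GRing.opprB GRing.opprD GRing.addrCA GRing.addNKr.
  rewrite inE => /andP[er]; rewrite inE er andTb negb_exists => /forallP/(_ a).
  by rewrite -leqNgt.
have mr' : m.+2 <= r.+1 by [].
have m0 : 0 < m.+2 by [].
have [i im imax] := @arg_maxnP _ (ord0 : 'I_r.+1) (fun i : 'I_r.+1 => i < m.+2)
  (fun i => (f i - a)%R : nat) m0.
have := few i im; rewrite leqNgt => /negP; apply.
have <- : #|[set j : 'I_r.+1 | j < m.+2] :\ i| = m.+1.
  have := cardsD1 i [set j : 'I_r.+1 | j < m.+2].
  rewrite inE im add1n.
  have -> : #|[set j : 'I_r.+1 | j < m.+2]| = m.+2; last by case.
  rewrite -sum1_card; under eq_bigl do rewrite inE.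
  by rewrite (big_ord_narrow mr') sum1_card card_ord.
rewrite -(card_imset _ fi); apply/subset_leq_card/fintype.subsetP => v.
move=> /imsetP[j]; rewrite !inE => /andP[ji jm] ->.
rewrite imset_f ?inE // andTb ltn_neqAle; apply/andP; split; last exact: imax.
by apply: contra ji => /eqP/val_inj/GRing.addIr/fi ->.
Qed.

(** For a fixed r-set the length of the forbidden arcs takes each value once
    when c runs over the cycle. *)
Lemma sum_cyclic_graph : m < r ->
  \sum_(lam < n.+1) ('C(n.+1, r) - #|overfull_sets lam|) <=
  n.+1 * turan_number r (Hrk r m.+2) n.+1.
Proof.
move=> mr.
have -> : \sum_(lam < n.+1) ('C(n.+1, r) - #|overfull_sets lam|) =
    \sum_(c : 'I_n.+1) #|cyclic_graph c|.
  pose P (e : {set 'I_n.+1}) (lam : 'I_n.+1) := (#|e| == r) && (e \notin overfull_sets lam).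
  transitivity (\sum_(lam < n.+1) \sum_(e | P e lam) 1).
    apply: eq_bigr => lam _; rewrite sum1_card.
    have -> : 'C(n.+1, r) = #|[set e : {set 'I_n.+1} | #|e| == r]|.
      by rewrite card_draws card_ord.
    have sub : overfull_sets lam \subset [set e : {set 'I_n.+1} | #|e| == r].
      by apply/fintype.subsetP => e; rewrite !inE => /andP[].
    rewrite -[in LHS](finset.setIidPr sub) -cardsD.
    by apply: eq_card => e; rewrite finset.in_setD andbC inE.
  rewrite (exchange_big_dep (fun e : {set 'I_n.+1} => #|e| == r)) /=; last by move=> lam e _ /andP[].
  rewrite [RHS](eq_bigr (fun c => \sum_(e in cyclic_graph c) 1)); last first.
    by move=> c _; rewrite sum1_card.
  rewrite [RHS](exchange_big_dep (fun e : {set 'I_n.+1} => #|e| == r)) /=; last first.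
    by move=> lam e _; rewrite inE => /andP[].
  apply: eq_bigr => e er.
  rewrite (reindex_inj (@GRing.addIr _ (- \sum_(v in e) v)%R)).
  by apply: eq_bigl => c; rewrite /P [RHS]inE.
rewrite -[X in X * _](card_ord n.+1) -sum_nat_const; apply: leq_sum => c _.
apply: turan_numberP; [exact: cyclic_graph_rgraph|exact: cyclic_graph_free].
Qed.

End CyclicGraph.

(** * A maximal inequality for random r-sets *)

Section Maximal.
Variable R : realType.
Local Open Scope ring_scope.

(** The left-hand side is the sum over injective r-tuples.  It replaces the
    moment generating function of a hypergeometric variable by that of a
    binomial one. *)
Lemma elementary_symmetric_le (V : finType) (a : V -> R) (r : nat) :
  (forall v, 0 <= a v) ->
  r`!%:R * (\sum_(e : {set V} | #|e| == r) \prod_(v in e) a v) <=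
  (\sum_v a v) ^+ r.
Proof.
move=> a0; have sa0 : 0 <= \sum_v a v by exact: sumr_ge0.
elim: r => [|r IH].
  rewrite fact0 mul1r expr0 (eq_bigl (pred1 finset.set0)) => [|e]; last by rewrite cards_eq0.
  by rewrite big_pred1_eq big_set0.
have Gr : is_rgraph r.+1 [set e : {set V} | #|e| == r.+1].
  by apply/forall_inP => e; rewrite inE.
have E := big_remove +%R (fun (S : {set V}) x => a x * \prod_(v in S) a v) Gr.
have {}E : r.+1%:R * (\sum_(e : {set V} | #|e| == r.+1) \prod_(v in e) a v) =
    \sum_(S : {set V} | #|S| == r) \sum_(x | (x \notin S) &&
      (x |: S \in [set e : {set V} | #|e| == r.+1])) a x * \prod_(v in S) a v.
  rewrite E big_distrr /=; apply: eq_big => [e|e /eqP er]; first by rewrite inE.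
  rewrite [RHS](eq_bigr (fun=> \prod_(v in e) a v)) => [|x xe].
    by rewrite sumr_const er mulr_natl.
  by rewrite -big_setD1.
rewrite factS mulnC natrM -mulrA E exprS.
apply: le_trans (ler_wpM2l sa0 IH).
rewrite mulrCA ler_wpM2l // big_distrr /= ler_sum // => S _.
rewrite -big_distrl /= ler_wpM2r ?prodr_ge0 //.
rewrite [leRHS](bigID (fun x => (x \notin S) &&
  (x |: S \in [set e : {set V} | #|e| == r.+1]))) /=.
by rewrite lerDl sumr_ge0.
Qed.

(** The bound exp(- u) >= 1 - u gives the claim for |x| <= 1/3; squaring it at
    x / 2 doubles the range. *)
Lemma expR_le_quad (x : R) : `|x| <= 2 / 3 -> expR x <= 1 + x + x ^+ 2.
Proof.
have small (y : R) : `|y| <= 1 / 3 -> expR y <= 1 + y + y ^+ 2.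
  rewrite ler_norml => /andP[y1 y2].
  have h := expR_ge1Dx (- (y / 2)).
  have -> : expR y = (expR (- (y / 2)) ^+ 2)^-1.
    by rewrite -expRM_natl -expRN; congr expR; field.
  have p0 : 0 < (1 - y / 2) ^+ 2 by apply: exprn_gt0; lra.
  have p1 : (1 - y / 2) ^+ 2 <= expR (- (y / 2)) ^+ 2.
    by rewrite lerXn2r ?nnegrE ?expR_ge0 //; lra.
  rewrite invf_ple ?posrE ?exprn_gt0 ?expR_gt0 //; last by nra.
  apply: le_trans p1; rewrite -[leLHS]mul1r ler_pdivrMr; nra.
move=> hx; have := small (x / 2).
rewrite normrM [X in _ * X]ger0_norm ?invr_ge0 // => /(_ _) h.
have {}h : expR (x / 2) <= 1 + x / 2 + (x / 2) ^+ 2 by apply: h; lra.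
have -> : expR x = expR (x / 2) ^+ 2 by rewrite -expRM_natl; congr expR; field.
move: hx; rewrite ler_norml => /andP[x1 x2].
have : expR (x / 2) ^+ 2 <= (1 + x / 2 + (x / 2) ^+ 2) ^+ 2.
  by rewrite lerXn2r ?nnegrE ?expR_ge0 //; nra.
move/le_trans; apply.
rewrite -subr_ge0.
have -> : 1 + x + x ^+ 2 - (1 + x / 2 + (x / 2) ^+ 2) ^+ 2 =
  x ^+ 2 / 16 * (4 - 4 * x - x ^+ 2) by field.
by apply: mulr_ge0; [rewrite divr_ge0 ?sqr_ge0|nra].
Qed.

Section Prefix.
Variables (n r : nat).
Local Notation N := n.+1.
Implicit Types e : {set 'I_N}.

Definition prefix_count e (t : nat) : nat := #|[set v in e | (v < t)%N]|.

Lemma prefix_countE e t : (prefix_count e t)%:R = \sum_(v in e) (v < t)%:R :> R.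
Proof.
rewrite /prefix_count -sum1_card natr_sum big_mkcond [RHS]big_mkcond /=.
by apply: eq_bigr => v _; rewrite inE; case: (v \in e); case: (_ < t)%N.
Qed.

Lemma prefix_count_tperm e t (x y : 'I_N) : (x < t)%N -> (y < t)%N ->
  prefix_count [set tperm x y v | v in e] t = prefix_count e t.
Proof.
move=> xt yt; rewrite /prefix_count -[RHS](card_imset _ (@perm_inj _ (tperm x y))).
apply: eq_card => v; rewrite !inE.
have tt u : (tperm x y u < t)%N = (u < t)%N.
  by case: tpermP => [->|->|]; rewrite ?xt ?yt.
apply/andP/imsetP => [[/imsetP[u ue ->]]|[u + ->]].
  by rewrite tt => ut; exists u; rewrite // inE ue.
by rewrite inE tt => /andP[ue ->]; rewrite imset_f.
Qed.

Lemma sum_ord_lt (t : nat) : (t <= N)%N -> \sum_(v < N) (v < t)%:R = t%:R :> R.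
Proof.
move=> tN; rewrite -natr_sum; congr (_%:R).
by rewrite -big_mkcond /= (big_ord_narrow tN) sum1_card card_ord.
Qed.

(** A weight that does not distinguish the first t positions gives each of
    them the same mass K, so both sides equal s * t * K.  This is the reverse
    martingale property of prefix_count e t / t. *)
Lemma mean_prefix (w : {set 'I_N} -> R) (s t : nat) :
  (s <= t)%N -> (t <= N)%N ->
  (forall (x y : 'I_N) e, (x < t)%N -> (y < t)%N ->
     w [set tperm x y v | v in e] = w e) ->
  t%:R * (\sum_e w e * (prefix_count e s)%:R) =
  s%:R * (\sum_e w e * (prefix_count e t)%:R).
Proof.
move=> st tN wt.
have [t0|t0] := posnP t.
  by move: st; rewrite t0 leqn0 => /eqP ->.
have N0 : (0 < N)%N by [].
pose K (v : 'I_N) := \sum_(e : {set 'I_N} | v \in e) w e.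
have KE u : (u <= t)%N ->
    \sum_e w e * (prefix_count e u)%:R = u%:R * K ord0.
  move=> ut.
  under eq_bigr => e _ do rewrite prefix_countE big_distrr /= big_mkcond /=.
  rewrite exchange_big /= -(sum_ord_lt (leq_trans ut tN)) big_distrl /=.
  apply: eq_bigr => v _; case: (ltnP v u) => vu; last first.
    by rewrite mul0r big1 // => e _; rewrite mulr0 if_same.
  rewrite mul1r -big_mkcond /=; under eq_bigr do rewrite mulr1.
  rewrite /K (reindex_inj (imset_inj (@perm_inj _ (tperm v ord0)))) /=.
  apply: eq_big => e; last first.
    by move=> _; apply: wt; rewrite // (leq_trans vu).
  by rewrite -[X in X \in _](tpermR v ord0) mem_imset //; exact: perm_inj.
by rewrite !KE // mulrCA.
Qed.

(** Doob's inequality for the reverse submartingale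
    exp(theta * t0 * prefix_count e t / t).  The event is split by the last
    time t at which it occurs; that part depends on e only through its counts
    at t and later, so conditionally the mean of the count at t0 is t0 / t
    times the count at t, and the convexity of exp does the rest. *)
Lemma maximal_prefix (rho theta w : R) (t0 t1 : nat) :
  (0 < t0)%N -> (t0 <= t1)%N -> (t1 <= N)%N -> 0 <= w ->
  #|[set e : {set 'I_N} | (#|e| == r) && [exists t : 'I_t1.+1,
      (t0 <= t)%N && (w <= theta * ((prefix_count e t)%:R - rho * t%:R))]]|%:R
    * expR (theta * rho * t0%:R + w * (t0%:R / t1%:R)) <=
  \sum_(e : {set 'I_N} | #|e| == r) expR (theta * (prefix_count e t0)%:R).
Proof.
move=> t00 t01 t1N w0.
pose c (e : {set 'I_N}) (t : nat) := (t0 <= t)%N && (w <= theta * ((prefix_count e t)%:R - rho * t%:R)).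
pose A (t : 'I_t1.+1) (e : {set 'I_N}) := (#|e| == r) && c e t &&
  [forall t' : 'I_t1.+1, (t < t')%N ==> ~~ c e t'].
pose X := expR (theta * rho * t0%:R + w * (t0%:R / t1%:R)).
set E := [set e | _].
have EA e : (e \in E)%:R = \sum_t (A t e)%:R :> R.
  case: (boolP (e \in E)) => eE; last first.
    rewrite big1 // => t _; rewrite (_ : A t e = false) //; apply/negP.
    move=> /andP[/andP[er ct] _]; case/negP: eE; rewrite inE er.
    by apply/existsP; exists t.
  move: eE; rewrite inE => /andP[er /existsP[s0 cs0]].
  have [s cs smax] := @arg_maxnP _ s0 (fun s : 'I_t1.+1 => c e s) (fun s => s) cs0.
  have As : A s e.
    rewrite /A er cs; apply/forallP => t'; apply/implyP; apply: contraTN => /smax.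
    by rewrite /= -leqNgt.
  rewrite (bigD1 s) //= As big1 ?addr0 // => t ts.
  rewrite (_ : A t e = false) //; apply/negP => /andP[/andP[_ ct] /forallP h].
  have lts : (t < s)%N by rewrite ltn_neqAle ts; exact: smax.
  by have := h s; rewrite lts cs.
have step (t : 'I_t1.+1) : \sum_e (A t e)%:R * X <=
    \sum_e (A t e)%:R * expR (theta * (prefix_count e t0)%:R).
  have [tt0|t0t] := ltnP t t0.
    rewrite le_eqVlt; apply/orP; left; apply/eqP; apply: eq_bigr => e _.
    by rewrite /A /c leqNgt tt0 /= andbF !mul0r.
  have tt1 : (t <= t1)%N by rewrite -ltnS.
  have tR : (0 : R) < t%:R by rewrite ltr0n (leq_trans t00).
  have t1R : (0 : R) < t1%:R by rewrite ltr0n (leq_trans t00).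
  pose m (e : {set 'I_N}) : R := theta * ((prefix_count e t)%:R * t0%:R / t%:R).
  pose W (e : {set 'I_N}) : R := (A t e)%:R * expR (m e).
  have invW (x y : 'I_N) e : (x < t)%N -> (y < t)%N ->
      W [set tperm x y v | v in e] = W e.
    move=> xt yt.
    have P t' : (t <= t')%N ->
        prefix_count [set tperm x y v | v in e] t' = prefix_count e t'.
      by move=> ht; apply: prefix_count_tperm; apply: leq_trans ht.
    rewrite /W /m P //; congr (_%:R * _); rewrite /A card_imset; last exact: perm_inj.
    rewrite /c P //; congr (_ && _); apply: eq_forallb => t'.
    by case: (ltnP t t') => // tt'; rewrite P // ltnW.
  have mean := mean_prefix t0t (leq_trans tt1 t1N) invW.
  have sumW : \sum_e W e * (theta * (prefix_count e t0)%:R - m e) = 0.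
    under eq_bigr => e _.
      rewrite mulrBr (_ : W e * m e =
        theta * t0%:R / t%:R * (W e * (prefix_count e t)%:R)); last first.
        by rewrite /m; field; rewrite gt_eqF.
      rewrite mulrCA; over.
    rewrite big_split /= sumrN -!big_distrr /=.
    apply/eqP; rewrite subr_eq0 -[theta * t0%:R / t%:R]mulrA -[X in _ == X]mulrA.
    apply/eqP; congr (_ * _); apply: (mulfI (lt0r_neq0 tR)).
    by rewrite mean mulrA mulrCA mulfV ?mulr1 ?gt_eqF.
  (* exp lies above its tangent at m e, and the linear term sums to zero. *)
  apply: (@le_trans _ _ (\sum_e (W e + W e * (theta * (prefix_count e t0)%:R - m e)))).
    rewrite big_split /= sumW addr0; apply: ler_sum => e _.
    rewrite /W; case: (boolP (A t e)) => At; last by rewrite !mul0r.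
    rewrite !mul1r ler_expR.
    move: At => /andP[/andP[_ /andP[_ cw]] _].
    have -> : m e = theta * ((prefix_count e t)%:R - rho * t%:R) * (t0%:R / t%:R)
        + theta * rho * t0%:R by rewrite /m; field; rewrite gt_eqF.
    rewrite addrC lerD2r; apply: (@le_trans _ _ (w * (t0%:R / t%:R))).
      rewrite ler_wpM2l // ler_wpM2l // lef_pV2 ?posrE // ler_nat //.
    by rewrite ler_wpM2r // divr_ge0.
  apply: ler_sum => e _; rewrite /W -[X in X + _]mulr1 -mulrDr -mulrA ler_wpM2l //.
  rewrite -[X in _ <= expR X](subrK (m e)) expRD [leRHS]mulrC ler_wpM2l ?expR_ge0 //.
  exact: expR_ge1Dx.
rewrite -sum1_card natr_sum big_mkcond /= big_distrl /=.
rewrite (eq_bigr (fun e => \sum_t (A t e)%:R * X)); last first.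
  move=> e _; rewrite -big_distrl /= -EA; by case: (e \in E).
rewrite exchange_big /=; apply: (le_trans (ler_sum _ (fun t _ => step t))).
rewrite exchange_big /= [leRHS]big_mkcond /=; apply: ler_sum => e _.
rewrite -big_distrl /= -EA inE; case: (#|e| == r) => /=; last by rewrite mul0r.
by rewrite ler_piMl ?expR_ge0 // lern1 leq_b1.
Qed.

(** The hypothesis on n and r says that at least half of the r-tuples of
    vertices are injective; it costs the factor 2. *)
Lemma prefix_mgf (theta : R) (t : nat) :
  (t <= N)%N -> `|theta| <= 2 / 3 -> (N ^ r <= 2 * (r`! * 'C(N, r)))%N ->
  \sum_(e : {set 'I_N} | #|e| == r) expR (theta * (prefix_count e t)%:R) <=
  2 * 'C(N, r)%:R * expR ((theta + theta ^+ 2) * (r%:R / N%:R) * t%:R).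
Proof.
move=> tN th hN; have NR : (0 : R) < N%:R by rewrite ltr0n.
pose a (v : 'I_N) := expR (theta * (v < t)%:R).
rewrite (eq_bigr (fun e => \prod_(v in e) a v)); last first.
  by move=> e _; rewrite prefix_countE big_distrr expR_sum.
have fR : (0 : R) < r`!%:R by rewrite ltr0n fact_gt0.
rewrite -(ler_pM2l fR) (le_trans (elementary_symmetric_le r _)) //.
  by move=> v; exact: expR_ge0.
have sa : \sum_v a v <= N%:R * expR ((theta + theta ^+ 2) / N%:R * t%:R).
  apply: (@le_trans _ _ (N%:R + t%:R * (theta + theta ^+ 2))).
    rewrite -(sum_ord_lt tN) -[X in X%:R + _]card_ord -sum1_card natr_sum.
    rewrite big_distrl /= -big_split /=; apply: ler_sum => v _; rewrite /a.
    case: (v < t)%N; last by rewrite mulr0n mulr0 expR0 mul0r addr0.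
    by rewrite (_ : true%:R = 1 :> R) // mulr1 mul1r addrA expR_le_quad.
  apply: le_trans (ler_wpM2l (ltW NR) (expR_ge1Dx _)).
  by rewrite [leRHS]mulrDr mulr1 lerD2l le_eqVlt; apply/orP; left; apply/eqP; field;
     rewrite gt_eqF.
have sa0 : 0 <= \sum_v a v by apply: sumr_ge0 => v _; exact: expR_ge0.
apply: (@le_trans _ _ ((N%:R * expR ((theta + theta ^+ 2) / N%:R * t%:R)) ^+ r)).
  by rewrite lerXn2r ?nnegrE ?mulr_ge0 ?expR_ge0.
rewrite exprMn -expRM_natl -natrX [leRHS]mulrA.
have -> : r%:R * ((theta + theta ^+ 2) / N%:R * t%:R) =
  (theta + theta ^+ 2) * (r%:R / N%:R) * t%:R by field; rewrite gt_eqF.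
rewrite ler_wpM2r ?expR_ge0 //.
by rewrite mulrCA -!natrM ler_nat.
Qed.

End Prefix.
End Maximal.

(** * Deviations of arcs *)

Section ArcDeviation.
Variables (R : realType) (n r : nat).
Local Open Scope ring_scope.
Local Notation N := n.+1.
Implicit Types e : {set 'I_N}.
Hypothesis hN : (N ^ r <= 2 * (r`! * 'C(N, r)))%N.
Let rho : R := r%:R / N%:R.

Lemma arc_tail (theta w : R) (t0 t1 : nat) (g : 'I_N) :
  (0 < t0)%N -> (t0 <= t1)%N -> (t1 <= N)%N -> 0 <= w -> `|theta| <= 2 / 3 ->
  #|[set e : {set 'I_N} | (#|e| == r) && [exists t : 'I_t1.+1,
      (t0 <= t)%N && (w <= theta * ((arc_count e g t)%:R - rho * t%:R))]]|%:R
    <= 2 * 'C(N, r)%:R * expR (theta ^+ 2 * rho * t0%:R - w * (t0%:R / t1%:R)).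
Proof.
move=> t00 t01 t1N w0 th.
have := le_trans (maximal_prefix r rho theta t00 t01 t1N w0)
  (prefix_mgf (leq_trans t01 t1N) th hN).
rewrite -ler_pdivlMr ?expR_gt0 // -expRN -[leRHS]mulrA -expRD => h.
have -> : theta ^+ 2 * rho * t0%:R - w * (t0%:R / t1%:R) =
  (theta + theta ^+ 2) * (r%:R / N%:R) * t0%:R +
  - (theta * rho * t0%:R + w * (t0%:R / t1%:R)) by rewrite /rho; ring.
apply: le_trans h; rewrite ler_nat.
have hi : injective (fun e : {set 'I_N} => [set (v - g)%R | v in e]).
  by apply: imset_inj; exact: addIr.
rewrite -(card_imset _ hi); apply/subset_leq_card/fintype.subsetP => _ /imsetP[e + ->].
rewrite !inE card_imset; last exact: addIr.
move=> /andP[-> /existsP[t ht]] /=; apply/existsP; exists t.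
move: ht; rewrite arc_count_shift; congr (_ && (_ <= _ * (_%:R - _))).
by apply: eq_card => v; rewrite !inE subr0.
Qed.

Lemma inZpD (x y : nat) : inZp (x + y) = inZp x + inZp y :> 'I_N.
Proof. by apply: val_inj; rewrite /= modnDm. Qed.

(** An arc is the difference of two arcs that start at a multiple of h.  The
    starting point is chosen at distance at least h, and not 0, because the
    maximal inequality is useful only when the lengths it ranges over have a
    bounded ratio. *)
Lemma arc_decomposition e (a : 'I_N) (lam h : nat) :
  (0 < h)%N -> (2 * h + lam <= N)%N ->
  exists (j : 'I_(N %/ h).+1) (d : nat), (h <= d <= 2 * h)%N /\
    (arc_count e a lam + arc_count e (inZp (j * h) - inZp h)%R d =
     arc_count e (inZp (j * h) - inZp h)%R (d + lam))%N.
Proof.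
move=> h0 hlam.
have jlt : (a %/ h < (N %/ h).+1)%N by rewrite ltnS leq_div2r // ltnW.
exists (Ordinal jlt), (h + a %% h)%N; split.
  by rewrite leq_addr mul2n -addnn leq_add2l ltnW // ltn_pmod.
have hm : (a %% h < h)%N by rewrite ltn_pmod.
rewrite [RHS]arc_countD; last by lia.
rewrite addnC; congr (_ + arc_count _ _ _)%N.
rewrite inZpD addrA subrK -inZpD -divn_eq.
by rewrite valZpK.
Qed.

(** A deviation y of the arc forces a deviation 2y/3 of the longer arc in
    arc_decomposition or one of y/3, in the opposite direction, of the shorter
    one.  The shorter one has variance smaller by a factor of order h / lam,
    which pays for the smaller deviation, the ratio 2 of its lengths and a
    parameter four times larger in the exponential moment.  The factor
    72 = 18 * 2 * 2 comes from the at most 18 N / lam starting points, the two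
    cases and the factor 2 of arc_tail. *)
Lemma arc_deviation (sigma y theta : R) (lam h : nat) :
  (0 < h)%N -> (16 * h <= lam)%N -> (lam <= 17 * h)%N -> (2 * lam <= N)%N ->
  `|sigma| = 1 -> 0 <= y -> 0 <= theta -> theta <= 1 / 6 ->
  #|[set e : {set 'I_N} | (#|e| == r) && [exists a,
      y <= sigma * ((arc_count e a lam)%:R - rho * lam%:R)]]|%:R <=
  72 * (N%:R / lam%:R) * 'C(N, r)%:R *
    expR (17 / 16 * theta ^+ 2 * (rho * lam%:R) - 17 / 27 * (theta * y)).
Proof.
move=> h0 lam16 lam17 lamN sg y0 th0 th6.
have lam0 : (0 < lam)%N by lia.
have [hN2 hlamN] : (2 * h <= N)%N /\ (2 * h + lam <= N)%N by lia.
have hl0 : (0 < h + lam)%N by lia.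
have hll : (h + lam <= 2 * h + lam)%N by lia.
have lam_le : (lam <= N)%N by lia.
set D := [set e | _].
pose g (j : 'I_(N %/ h).+1) : 'I_N := inZp (j * h) - inZp h.
(* near and far: the shorter and the longer arc from g j deviate too much. *)
pose near j := [set e : {set 'I_N} | (#|e| == r) && [exists t : 'I_(2 * h).+1,
  (h <= t)%N && (4 * theta * (y / 3) <=
    - (4 * sigma * theta) * ((arc_count e (g j) t)%:R - rho * t%:R))]].
pose far j := [set e : {set 'I_N} | (#|e| == r) && [exists t : 'I_(2 * h + lam).+1,
  (h + lam <= t)%N && (theta * (2 * y / 3) <=
    (sigma * theta) * ((arc_count e (g j) t)%:R - rho * t%:R))]].
pose B := expR (17 / 16 * theta ^+ 2 * (rho * lam%:R) - 17 / 27 * (theta * y)).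
have hR : (0 : R) < h%:R by rewrite ltr0n.
have lamR : (0 : R) < lam%:R by rewrite ltr0n.
have NR : (0 : R) < N%:R by rewrite ltr0n.
have l16 : 16 * h%:R <= lam%:R :> R by rewrite -natrM ler_nat.
have l17 : lam%:R <= 17 * h%:R :> R by rewrite -natrM ler_nat.
have rho0 : 0 <= rho by rewrite divr_ge0.
have sg2 : sigma ^+ 2 = 1 by rewrite -real_normK ?num_real // sg expr1n.
have DS : D \subset \bigcup_j (near j :|: far j).
  apply/fintype.subsetP => e; rewrite inE => /andP[er /existsP[a ya]].
  have [j [d [/andP[hd d2] dE]]] := @arc_decomposition e a lam h h0 hlamN.
  apply/finset.bigcupP; exists j => //; rewrite !inE er /=.
  have [far_y|near_y] := leP (2 * y / 3)
     (sigma * ((arc_count e (g j) (d + lam))%:R - rho * (d + lam)%:R)).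
    apply/orP; right; apply/existsP.
    have dl : (d + lam < (2 * h + lam).+1)%N by rewrite ltnS leq_add2r.
    exists (Ordinal dl) => /=; rewrite leq_add2r hd /=.
    by rewrite [sigma * theta]mulrC -[leRHS]mulrA ler_wpM2l.
  apply/orP; left; apply/existsP.
  have dl : (d < (2 * h).+1)%N by rewrite ltnS.
  exists (Ordinal dl) => /=; rewrite hd /=.
  have dER : (arc_count e a lam)%:R + (arc_count e (g j) d)%:R =
      (arc_count e (g j) (d + lam))%:R :> R by rewrite -natrD dE.
  have -> : - (4 * sigma * theta) * ((arc_count e (g j) d)%:R - rho * d%:R) =
    4 * theta * - (sigma * ((arc_count e (g j) d)%:R - rho * d%:R)) by ring.
  apply: ler_wpM2l; first by rewrite mulr_ge0.
  move: near_y ya; rewrite -dER natrD !mulrDr !mulrN !mulrDr; lra.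
have near_le j : #|near j|%:R <= 2 * 'C(N, r)%:R * B.
  apply: le_trans (arc_tail _ h0 _ hN2 _ _) _.
  - by rewrite leq_pmull.
  - by rewrite !mulr_ge0 ?divr_ge0.
  - by rewrite normrN !normrM sg mulr1 !ger0_norm //; lra.
  rewrite ler_wpM2l // ler_expR sqrrN !exprMn sg2 natrM.
  have -> : h%:R / (2 * h%:R) = 1 / 2 :> R by field; rewrite gt_eqF.
  have := mulr_ge0 rho0 (sqr_ge0 theta); have := mulr_ge0 th0 y0.
  set q := rho * theta ^+ 2; move=> ty q0.
  have -> : 4 ^+ 2 * 1 * theta ^+ 2 * rho * h%:R = q * (16 * h%:R) by rewrite /q; ring.
  have -> : 17 / 16 * theta ^+ 2 * (rho * lam%:R) = q * (17 / 16 * lam%:R)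
    by rewrite /q; ring.
  have : q * (16 * h%:R) <= q * (17 / 16 * lam%:R) by apply: ler_wpM2l; lra.
  lra.
have far_le j : #|far j|%:R <= 2 * 'C(N, r)%:R * B.
  apply: le_trans (arc_tail _ hl0 hll hlamN _ _) _.
  - by rewrite !mulr_ge0 ?invr_ge0.
  - by rewrite !normrM sg mul1r !ger0_norm //; lra.
  rewrite ler_wpM2l // ler_expR !exprMn sg2 mul1r.
  have := mulr_ge0 rho0 (sqr_ge0 theta); have := mulr_ge0 th0 y0.
  set q := rho * theta ^+ 2; move=> ty q0.
  have -> : theta ^+ 2 * rho * (h + lam)%:R = q * (h + lam)%:R by rewrite /q; ring.
  have -> : 17 / 16 * theta ^+ 2 * (rho * lam%:R) = q * (17 / 16 * lam%:R)
    by rewrite /q; ring.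
  have h1 : q * (h + lam)%:R <= q * (17 / 16 * lam%:R).
    by apply: ler_wpM2l => //; rewrite natrD; lra.
  have h2 : 17 / 18 <= (h + lam)%:R / (2 * h + lam)%:R :> R.
    have E1 : (2 * h + lam)%:R = 2 * h%:R + lam%:R :> R by rewrite natrD natrM.
    have E2 : (h + lam)%:R = h%:R + lam%:R :> R by rewrite natrD.
    by rewrite E1 E2 ler_pdivlMr; lra.
  have : theta * y * (17 / 18) <= theta * y * ((h + lam)%:R / (2 * h + lam)%:R).
    exact: ler_wpM2l.
  lra.
have card_le : (#|D| <= \sum_j (#|near j| + #|far j|))%N.
  apply: leq_trans (subset_leq_card DS) _.
  elim/big_rec2: _ => [|j x A _ IH]; first by rewrite cards0.
  apply: leq_trans (leq_card_setU _ _) _; apply: leq_add IH.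
  exact: leq_card_setU.
apply: (@le_trans _ _ (\sum_(j < (N %/ h).+1) (4 * 'C(N, r)%:R * B))).
  move: card_le; rewrite -(ler_nat R) natr_sum => /le_trans; apply.
  apply: ler_sum => j _; rewrite natrD; have := near_le j; have := far_le j; lra.
rewrite sumr_const card_ord -[leLHS]mulr_natl.
have jR : (N %/ h).+1%:R <= 18 * (N%:R / lam%:R) :> R.
  rewrite -addn1 natrD.
  have : (N %/ h)%:R <= 17 * (N%:R / lam%:R) :> R.
    rewrite mulrA ler_pdivlMr //; apply: (@le_trans _ _ ((N %/ h)%:R * (17 * h%:R))).
      exact: ler_wpM2l.
    by rewrite mulrCA ler_wpM2l // -natrM ler_nat leq_trunc_div.
  have : 1 <= N%:R / lam%:R :> R.
    by rewrite ler_pdivlMr // mul1r ler_nat.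
  lra.
rewrite -/B.
have CB : 0 <= 4 * 'C(N, r)%:R * B by rewrite !mulr_ge0 ?expR_ge0.
apply: le_trans (ler_wpM2r CB jR) _.
rewrite le_eqVlt; apply/orP; left; apply/eqP; ring.
Qed.

End ArcDeviation.

(** * Overfull arcs are rare *)

Lemma expn_le_ffact (n k : nat) : (n ^ k * (n - k ^ 2) <= n * n ^_ k)%N.
Proof.
elim: k => [|k IH]; first by rewrite expn0 ffactn0 mul1n muln1 leq_subr.
have [nk|kn] := leqP n (k.+1 ^ 2); first by rewrite (eqP nk) muln0.
rewrite ffactnSr mulnA; apply: leq_trans (leq_mul IH (leqnn _)).
rewrite expnS -mulnA [X in (X <= _)%N]mulnCA -mulnA leq_mul2l; apply/orP; right.
have [b ->] : exists b, n = (k.+1 ^ 2 + b)%N by exists (n - k.+1 ^ 2)%N; rewrite (subnKC (ltnW kn)).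
rewrite addKn -!mulnn.
have -> : (k.+1 * k.+1 + b - k * k = 2 * k + 1 + b)%N by nia.
have -> : (k.+1 * k.+1 + b - k = k * k + k + 1 + b)%N by nia.
nia.
Qed.

Lemma expn_le_fact_bin (n k : nat) : (2 * k ^ 2 <= n)%N ->
  (n ^ k <= 2 * (k`! * 'C(n, k)))%N.
Proof.
move=> kn; have [->|n0] := posnP n; first by case: k {kn} => [|k]; rewrite ?expn0 ?bin0 ?exp0n.
rewrite [(k`! * _)%N]mulnC bin_ffact -(leq_pmul2l n0).
apply: (@leq_trans (2 * (n ^ k * (n - k ^ 2)))%N); last first.
  by rewrite [X in (_ <= X)%N]mulnCA leq_mul2l expn_le_ffact.
rewrite [X in (X <= _)%N]mulnC mulnCA leq_mul2l; apply/orP; right; lia.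
Qed.

Section Overfull.
Variables (R : realType) (n r m q : nat).
Local Open Scope ring_scope.
Local Notation N := n.+1.
Hypothesis Nq : N = (2 * r * q)%N.
Hypothesis m0 : (0 < m)%N.
Hypothesis mr : (m < r)%N.
Hypothesis qbig : (240 + r <= q)%N.
Local Notation s := (minn m (r - m)).

Lemma overfull_sets_mono (lam lam' : nat) : (lam <= lam')%N ->
  overfull_sets n r m lam \subset overfull_sets n r m lam'.
Proof.
move=> ll; apply/fintype.subsetP => e; rewrite !inE => /andP[-> /existsP[a ha]] /=.
by apply/existsP; exists a; apply: leq_trans (arc_count_mono e a ll).
Qed.

Let y (lam : nat) : R := m%:R - lam%:R / (2 * q%:R).

(** Up to half of the cycle an overfull arc deviates upwards; beyond, its
    complement deviates downwards by the same amount.  In both cases the arc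
    used has between s / 2 and s + y points on average. *)
Lemma overfull_deviation (lam : nat) :
  (q * m <= lam)%N -> (lam <= 2 * q * m)%N ->
  exists sigma : R, exists lam' : nat,
  [/\ `|sigma| = 1, (q * s <= lam')%N, (2 * lam' <= N)%N,
      lam'%:R / (2 * q%:R) <= s%:R + y lam &
      overfull_sets n r m lam \subset [set e : {set 'I_N} | (#|e| == r) &&
        [exists a, y lam <= sigma * ((arc_count e a lam')%:R
          - (r%:R / N%:R) * lam'%:R)]]].
Proof.
move=> l1 l2.
have q0 : (0 < q)%N by lia.
have sm : (s <= m)%N by rewrite geq_minl.
have srm : (s <= r - m)%N by rewrite geq_minr.
have qR : (0 : R) < q%:R by rewrite ltr0n.
have rR : (0 : R) < r%:R by rewrite ltr0n; lia.
have rho : r%:R / N%:R = (2 * q%:R)^-1 :> R.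
  by rewrite Nq !natrM; field; rewrite !gt_eqF.
have [lh|lh] := leqP lam (r * q).
  exists 1, lam; split; first by rewrite normr1.
  - by apply: leq_trans l1; rewrite leq_mul2l sm orbT.
  - by rewrite Nq -mulnA leq_mul2l lh.
  - rewrite /y addrA -(lerD2r (lam%:R / (2 * q%:R))) subrK.
    have [mh|mh] := leqP m (r - m); first rewrite -natrD.
      rewrite -mulrDl ler_pdivrMr ?mulr_gt0 // -!natrM -natrD ler_nat; nia.
    rewrite -natrD subnK; last exact: ltnW.
    rewrite -mulrDl ler_pdivrMr ?mulr_gt0 // -!natrM -natrD ler_nat; nia.
  - apply/fintype.subsetP => e; rewrite !inE => /andP[-> /existsP[a ha]] /=.
    apply/existsP; exists a; rewrite mul1r rho /y [_^-1 * _]mulrC.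
    by rewrite lerD2r ler_nat ltnW.
have lN : (lam <= N)%N by rewrite Nq; nia.
have mh : (r - m < m)%N by nia.
exists (-1), (N - lam)%N; split; first by rewrite normrN1.
- rewrite Nq; nia.
- rewrite Nq; nia.
- rewrite /y (minn_idPr (ltnW mh)) natrB // natrB; last exact: ltnW.
  rewrite Nq !natrM le_eqVlt; apply/orP; left; apply/eqP; field.
  by rewrite gt_eqF.
- apply/fintype.subsetP => e; rewrite !inE => /andP[/eqP er /existsP[a ha]] /=.
  rewrite er eqxx; apply/existsP; exists (a + inZp lam).
  have hc : (arc_count e a lam + arc_count e (a + inZp lam)%R (N - lam) = r)%N.
    by rewrite -arc_countD subnKC // arc_count_full.
  have {}hc : (arc_count e a lam)%:R + (arc_count e (a + inZp lam) (N - lam))%:R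
      = r%:R :> R by rewrite -natrD hc.
  have hm : m%:R <= (arc_count e a lam)%:R :> R by rewrite ler_nat ltnW.
  have -> : r%:R / N%:R * (N - lam)%:R = r%:R - lam%:R / (2 * q%:R) :> R.
    rewrite natrB // mulrBr divfK; last by rewrite pnatr_eq0.
    by rewrite rho [_^-1 * _]mulrC.
  rewrite /y; lra.
Qed.

(** The variance term of arc_deviation is at most theta ^+ 2 * (s + y) up to
    a constant, and theta <= 1/6 lets the linear gain theta * y absorb the part
    of it that involves y. *)
Lemma overfull_sets_le (theta : R) (lam : nat) :
  0 <= theta -> theta <= 1 / 6 ->
  (q * m <= lam)%N -> (lam <= 2 * q * m)%N ->
  #|overfull_sets n r m lam|%:R <= 144 * (r%:R / s%:R) * 'C(N, r)%:R *
    expR (17 / 16 * theta ^+ 2 * s%:R - 9 / 20 * (theta * y lam)).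
Proof.
move=> th0 th6 l1 l2.
have s0 : (0 < s)%N by rewrite leq_min m0 subn_gt0.
have [sigma [lam' [sg ls lN mu sub]]] := overfull_deviation l1 l2.
have lbig : (240 <= lam')%N by nia.
have hN : (N ^ r <= 2 * (r`! * 'C(N, r)))%N.
  by apply: expn_le_fact_bin; rewrite Nq -mulnn; nia.
pose h := (lam' %/ 16)%N.
have lh : (16 * h <= lam')%N by rewrite mulnC leq_trunc_div.
have lh' : (lam' <= 17 * h)%N by rewrite /h; lia.
have h0 : (0 < h)%N by lia.
have q0 : (0 < q)%N by lia.
have lam'0 : (0 < lam')%N by lia.
have rq0 : (0 < r)%N by lia.
clear lbig.
have sR : (0 : R) < s%:R by rewrite ltr0n.
have qR : (0 : R) < q%:R by rewrite ltr0n.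
have rR : (0 : R) < r%:R by rewrite ltr0n.
have lR : (0 : R) < lam'%:R by rewrite ltr0n.
have y0 : 0 <= y lam.
  by rewrite subr_ge0 ler_pdivrMr ?mulr_gt0 // -!natrM ler_nat mulnC.
have dev := arc_deviation hN h0 lh lh' lN sg y0 th0 th6.
apply: le_trans (le_trans _ dev) _; first by rewrite ler_nat; exact: subset_leq_card.
have lsR : q%:R * s%:R <= lam'%:R :> R by rewrite -natrM ler_nat.
apply: ler_pM.
- by rewrite !mulr_ge0 ?invr_ge0.
- exact: expR_ge0.
- rewrite ler_wpM2r //.
  have -> : 144 * (r%:R / s%:R) = 72 * (2 * r%:R / s%:R) :> R by ring.
  rewrite ler_wpM2l // ler_pdivrMr // Nq !natrM -!mulrA ler_wpM2l // ler_wpM2l //.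
  by rewrite mulrC ler_pdivlMr.
rewrite ler_expR.
have -> : r%:R / N%:R * lam'%:R = lam'%:R / (2 * q%:R) :> R.
  by rewrite Nq !natrM; field; rewrite !gt_eqF.
have ty : 0 <= theta * y lam by exact: mulr_ge0.
have t2 := sqr_ge0 theta.
have h1 : theta ^+ 2 * (lam'%:R / (2 * q%:R)) <= theta ^+ 2 * (s%:R + y lam).
  exact: ler_wpM2l.
have h2 : theta ^+ 2 * y lam <= 1 / 6 * (theta * y lam).
  by rewrite expr2 -mulrA ler_wpM2r.
lra.
Qed.

(** For lengths below half of the critical one, 2 * q * m, the arcs become too
    short for a good bound; being overfull is monotone in the length, so the
    bound at q * m is used there, at the cost of a factor 2 in the exponent. *)
Lemma overfull_sets_le_exp (theta E : R) (lam : nat) :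
  0 <= theta -> theta <= 1 / 6 ->
  144 * (r%:R / s%:R) * expR (17 / 16 * theta ^+ 2 * s%:R) <= expR E ->
  (lam <= 2 * q * m)%N ->
  #|overfull_sets n r m lam|%:R <=
  'C(N, r)%:R * expR (E - 9 / 40 * (theta * y lam)).
Proof.
move=> th0 th6 hE l2.
have qR : (0 : R) < q%:R by rewrite ltr0n; lia.
pose lam1 := maxn lam (q * m).
have l1 : (q * m <= lam1)%N by rewrite leq_maxr.
have l12 : (lam1 <= 2 * q * m)%N by rewrite geq_max l2 leq_mul2r leq_pmull ?orbT.
have ll1 : (lam <= lam1)%N by rewrite leq_maxl.
apply: (@le_trans _ _ (#|overfull_sets n r m lam1|%:R)).
  by rewrite ler_nat subset_leq_card // overfull_sets_mono.
apply: le_trans (overfull_sets_le th0 th6 l1 l12) _.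
rewrite [in leLHS]expRD [in leRHS]expRD [144 * _ * _]mulrC -[leLHS]mulrA.
rewrite ler_wpM2l // (mulrA (144 * _)); apply: ler_pM => //.
rewrite ler_expR lerN2.
have : y lam <= 2 * y lam1.
  rewrite /lam1 /y; case: (leqP lam (q * m)%N) => lqm.
    have -> : (q * m)%:R / (2 * q%:R) = m%:R / 2 :> R.
      by rewrite natrM; field; rewrite gt_eqF.
    have : 0 <= lam%:R / (2 * q%:R) :> R by rewrite divr_ge0 // mulr_ge0.
    lra.
  have : lam%:R / (2 * q%:R) <= m%:R :> R.
    by rewrite ler_pdivrMr ?mulr_gt0 // -!natrM ler_nat mulnC.
  lra.
move=> /(ler_wpM2l th0); lra.
Qed.



End Overfull.


Section LowerBound.
Variable R : realType.
Local Open Scope ring_scope.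

(** The sum is a lower Riemann sum of the decreasing function
    x |-> min 1 (exp (E - b * x)) on the half-line, whose integral is
    (E + 1) / b. *)
Lemma sum_min_expR (E b : R) (M : nat) : 0 <= E -> 0 < b ->
  b * (\sum_(i < M) Num.min 1 (expR (E - b * i.+1%:R))) <= E + 1.
Proof.
(* Phi is an antiderivative of min 1 (exp u). *)
move=> E0 b0; pose Phi (u : R) := if 0 <= u then u + 1 else expR u.
have Phi0 u : 0 <= Phi u.
  by rewrite /Phi; case: ifP => [|_]; [lra|exact: expR_ge0].
have step u : b * Num.min 1 (expR u) <= Phi (u + b) - Phi u.
  rewrite /Phi; have [u0|u0] := leP 0 u.
    have -> : Num.min 1 (expR u) = 1.
      by apply/min_idPl; rewrite -[leLHS]expR0 ler_expR.
    have -> : 0 <= u + b by lra.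
    lra.
  have -> : Num.min 1 (expR u) = expR u.
    by apply/min_idPr; rewrite -[leRHS]expR0 ler_expR ltW.
  have e1 : expR u <= 1 by rewrite -[leRHS]expR0 ler_expR ltW.
  have e0 := expR_ge0 u.
  case: ifP => ub.
    have := expR_ge1Dx (- u); rewrite expRN => h.
    have : expR u * (1 - u) <= 1.
      by rewrite mulrC -ler_pdivlMr ?expR_gt0 // mul1r.
    nra.
  by rewrite expRD; have := expR_ge1Dx b; nra.
have : b * (\sum_(i < M) Num.min 1 (expR (E - b * i.+1%:R))) <= Phi E - Phi (E - b * M%:R).
  elim: M => [|M IH]; first by rewrite big_ord0 !mulr0 subr0 subrr.
  rewrite big_ord_recr /= mulrDr.
  have := step (E - b * M.+1%:R).
  have -> : E - b * M.+1%:R + b = E - b * M%:R by rewrite -addn1 natrD; ring.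
  lra.
by have := Phi0 (E - b * M%:R); rewrite {2}/Phi E0; lra.
Qed.

(** The numbers of vertices 2 * r * q make the critical lengths integers, so
    that no rounding error appears and the bound holds for each large q. *)
Lemma turan_density_lower (r m : nat) (theta E : R) :
  (0 < m)%N -> (m < r)%N -> 0 < theta -> theta <= 1 / 6 -> 0 <= E ->
  144 * (r%:R / (minn m (r - m))%:R) *
    expR (17 / 16 * theta ^+ 2 * (minn m (r - m))%:R) <= expR E ->
  m%:R / r%:R - 40 / 9 * (E + 1) / theta / r%:R
    <= turan_density R r (Hrk r m.+2).
Proof.
move=> m0 mr th0 th6 E0 hE.
have r0 : (0 < r)%N by lia.
apply: turan_density_ge => i.
have [q iq qbig] : exists2 q, (i <= 2 * r * q)%N & (240 + r <= q)%N.
  by exists (240 + r + i)%N; [nia|rewrite leq_addr].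
exists (2 * r * q)%N; first exact: iq.
have q0 : (0 < q)%N by lia.
clear i iq.
case Nq : (2 * r * q)%N => [|n]; first by nia.
have mu_le := sum_cyclic_graph n mr.
have C0 : (0 : R) < 'C(n.+1, r)%:R by rewrite ltr0n bin_gt0; nia.
have qR : (0 : R) < q%:R by rewrite ltr0n.
have rR : (0 : R) < r%:R by rewrite ltr0n.
have NR : n.+1%:R = 2 * r%:R * q%:R :> R by rewrite -Nq !natrM.
pose M := (2 * q * m)%N.
have MN : (M <= n.+1)%N by rewrite -Nq /M; nia.
pose b : R := 9 / 40 * theta / (2 * q%:R).
have b0 : 0 < b by rewrite !mulr_gt0 ?invr_gt0 ?mulr_gt0.
have lower : 'C(n.+1, r)%:R * (M%:R - (E + 1) / b) <=
    n.+1%:R * (turan_number r (Hrk r m.+2) n.+1)%:R.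
  rewrite -natrM; apply: (@le_trans _ _
     (\sum_(lam < n.+1) ('C(n.+1, r) - #|overfull_sets n r m lam|))%:R); last first.
    by rewrite ler_nat.
  rewrite natr_sum (bigID (fun lam : 'I_n.+1 => (lam < M)%N)) /=.
  apply: ler_wpDr; first exact: sumr_ge0.
  rewrite (big_ord_narrow MN) /=.
  apply: (@le_trans _ _ (\sum_(i < M) 'C(n.+1, r)%:R *
      (1 - Num.min 1 (expR (E - b * (M - i)%:R))))).
    rewrite -big_distrr /= ler_pM2l // sumrB sumr_const card_ord lerD2l lerN2.
    rewrite ler_pdivlMr // mulrC; apply: le_trans (sum_min_expR M E0 b0).
    rewrite ler_pM2l // (reindex_inj rev_ord_inj) /= le_eqVlt; apply/orP; left.
    apply/eqP; apply: eq_bigr => i _; congr (Num.min _ (expR (_ - _ * _%:R))).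
    by rewrite subKn.
  apply: ler_sum => lam _.
  have le_bin : (#|overfull_sets n r m lam| <= 'C(n.+1, r))%N.
    rewrite -[X in 'C(X, _)](card_ord n.+1) -card_draws; apply: subset_leq_card.
    by apply/fintype.subsetP => e; rewrite !inE => /andP[].
  rewrite (natrB _ le_bin) mulrBr mulr1 lerD2l lerN2.
  have lM : (lam <= 2 * q * m)%N by exact: ltnW.
  have := overfull_sets_le_exp (esym Nq) m0 mr qbig (ltW th0) th6 hE lM.
  have -> : 9 / 40 * (theta * (m%:R - lam%:R / (2 * q%:R))) = b * (M - lam)%:R.
    by rewrite natrB // /b /M !natrM; field; rewrite gt_eqF.
  rewrite minEle; case: ifP => // _ _.
  by rewrite mulr1 ler_nat.
rewrite ler_pdivlMr //.
have NR0 : (0 : R) < n.+1%:R by rewrite ltr0n.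
rewrite -(ler_pM2l NR0); apply: le_trans lower.
rewrite le_eqVlt; apply/orP; left; apply/eqP.
rewrite NR /M /b !natrM; field.
by rewrite !gt_eqF.
Qed.

End LowerBound.

(** * Choice of the parameters *)
Local Open Scope ring_scope.


Lemma ln2_gt (R : realType) : 29 / 50 <= ln 2 :> R.
Proof.
have h := expR_ge1Dx (- (29 / 200) : R).
have : expR (- (29 / 200)) ^+ 4 = (expR (29 / 50))^-1 :> R.
  by rewrite -expRM_natl -expRN; congr expR; field.
have h2 : (171 / 200) ^+ 4 <= expR (- (29 / 200)) ^+ 4 :> R.
  by apply: lerXn2r; rewrite ?nnegrE ?expR_ge0; lra.
move=> E; rewrite E in h2.
have h3 : expR (29 / 50) <= 2 :> R.
  rewrite -lef_pV2 ?posrE ?expR_gt0 //.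
  by apply: le_trans h2; lra.
by rewrite -[leLHS]expRK ler_ln ?posrE ?expR_gt0.
Qed.

Lemma expR6_gt (R : realType) : 144 <= expR 6 :> R.
Proof.
have h := expR_ge1Dx (1 / 4 : R).
have e4 : (5 / 4) ^+ 4 <= expR 1 :> R.
  have -> : expR 1 = expR (1 / 4) ^+ 4 :> R.
    by rewrite -expRM_natl; congr expR; field.
  by rewrite lerXn2r ?nnegrE ?expR_ge0 //; lra.
have -> : expR 6 = expR 1 ^+ 6 :> R by rewrite -expRM_natl mulr1.
apply: (@le_trans _ _ ((12 / 5) ^+ 6)); first lra.
by rewrite lerXn2r ?nnegrE ?expR_ge0 //; lra.
Qed.

(** With z = sqrt (s / L) the choice theta = 1 / (z + 6) balances L / theta
    against theta * s: both are at most of order z * L + L, that is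
    sqrt (s * L) + L.  The additive constants are absorbed by L >= 1 + ln 2,
    which holds because s <= r / 2. *)
Lemma turan_density_Hrk_lower (R : realType) (r m : nat) (L : R) :
  (0 < m)%N -> (m < r)%N ->
  let s : R := (minn m (r - m))%:R in
  L = ln (expR 1 * r%:R / s) ->
  m%:R / r%:R - 128 / r%:R * (Num.sqrt (s * L) + L)
    <= turan_density R r (Hrk r m.+2).
Proof.
move=> m0 mr s LE.
have s0 : 0 < s by rewrite ltr0n leq_min m0 subn_gt0.
have rR : (0 : R) < r%:R by rewrite ltr0n (leq_trans _ mr).
have rs2 : 2 <= r%:R / s.
  rewrite ler_pdivlMr // -natrM ler_nat; lia.
have {}LE : L = 1 + ln (r%:R / s).
  by rewrite LE -mulrA lnM ?posrE ?expR_gt0 ?divr_gt0 // expRK.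
have Lge : 79 / 50 <= L.
  have : ln 2 <= ln (r%:R / s) by rewrite ler_ln ?posrE ?divr_gt0.
  by have := ln2_gt R; rewrite LE; lra.
have eL : expR L = expR 1 * (r%:R / s).
  by rewrite LE expRD lnK // posrE divr_gt0.
have L0 : 0 < L by lra.
pose z := Num.sqrt (s * L) / L.
have z0 : 0 <= z by rewrite divr_ge0 ?sqrtr_ge0 // ltW.
have zL : Num.sqrt (s * L) = z * L by rewrite /z divfK ?gt_eqF.
have sE : s = z ^+ 2 * L.
  rewrite /z expr_div_n sqr_sqrtr ?mulr_ge0 ?ltW //.
  by field; rewrite gt_eqF.
pose theta := (z + 6)^-1.
have z6 : 0 < z + 6 by lra.
have th0 : 0 < theta by rewrite invr_gt0.
have th6 : theta <= 1 / 6.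
  by rewrite div1r lef_pV2 ?posrE //; lra.
pose E := L + 5 + 17 / 16 * theta ^+ 2 * s.
have ts0 : 0 <= theta ^+ 2 * s by rewrite mulr_ge0 ?sqr_ge0 // ltW.
have E0 : 0 <= E by rewrite /E; lra.
have hE : 144 * (r%:R / s) * expR (17 / 16 * theta ^+ 2 * s) <= expR E.
  rewrite /E expRD ler_wpM2r ?expR_ge0 // expRD eL mulrAC -expRD.
  rewrite ler_wpM2r ?(le_trans _ rs2) //.
  have -> : 1 + 5 = 6 :> R by lra.
  exact: expR6_gt.
apply: le_trans (turan_density_lower m0 mr th0 th6 E0 hE).
rewrite lerD2l lerN2 zL [128 / _ * _]mulrAC ler_pM2r ?invr_gt0 //.
have -> : 40 / 9 * (E + 1) / theta =
    40 / 9 * ((L + 6) * (z + 6) + 17 / 16 * (z ^+ 2 * L / (z + 6))).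
  rewrite /E sE /theta; field; exact: lt0r_neq0.
have h1 : z ^+ 2 * L / (z + 6) <= z * L.
  rewrite ler_pdivrMr //; nra.
have : 79 / 50 * z <= z * L by rewrite mulrC ler_wpM2l.
lra.
Qed.

Theorem theorem1p4 (R : realType) (r k : nat)
    (hr : (2 <= r)%N) (hk : (3 <= k <= r.+1)%N) :
  let s : R := (minn (k - 2) (r + 2 - k))%:R in
  let e : R := expR 1 in
  0 <= (k%:R - 2) / r%:R - turan_density R r (Hrk r k)
    <= 128 / r%:R * (Num.sqrt (s * ln (e * r%:R / s)) + ln (e * r%:R / s)).
Proof.
have /andP[k3 kr] := hk.
have [m kE] : exists m, k = m.+2 by exists (k - 2)%N; lia.
have m0 : (0 < m)%N by lia.
have mr : (m < r)%N by lia.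
have sE : minn (k - 2) (r + 2 - k) = minn m (r - m) by congr minn; lia.
have mE : k%:R - 2 = m%:R :> R by rewrite kE -addn2 natrD addrK.
cbv zeta; rewrite mE sE kE; apply/andP; split.
  rewrite subr_ge0; case: r hr {hk kr mr sE} => // r _.
  exact: turan_density_upper.
rewrite lerBlDr -lerBlDl.
exact: (turan_density_Hrk_lower m0 mr erefl).
Qed.
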